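(* Let $f,g:\mathbb{R}^n\to\mathbb{R}\cup\{+\infty\}$ be closed convex proper functions such that there exist $x^\star,u^\star\in\mathbb{R}^n$ with $0\in\partial f(x^\star)+u^\star$ and $0\in\partial g^*(u^\star)-x^\star$. Let $\alpha>0$, let $x^0,u^0\in\mathbb{R}^n$, and let $\{(x^k,u^k)\}_{k\ge 0}$ be generated by $$u^{k+1}=\mathrm{prox}_{\alpha^{-1}g^*}\big(u^k+\tfrac1\alpha x^k\big),\qquad x^{k+1}=\mathrm{prox}_{\alpha f}\big(x^k-\alpha(2u^{k+1}-u^k)\big),\qquad k=0,1,2,\dots$$ For $k\ge1$ let $p^k=\alpha u^{k-1}+x^{k-1}-\alpha u^k\in\partial g^*(u^k)$, let $\widetilde\nabla f(x^k)=\frac1\alpha\big(x^{k-1}-\alpha(2u^k-u^{k-1})-x^k\big)\in\partial f(x^k)$, and $v^k=\widetilde\nabla f(x^k)+u^k$. Let $K\ge1$ be an integer, $\bar x^K=\frac1K\sum_{k=1}^K x^k$, $\bar u^K=\frac1K\sum_{k=1}^K u^k$. Then for all $x,u\in\mathbb{R}^n$ and all subgradients $\bar p^K\in\partial g^*(\bar u^K)$, $p\in\partial g^*(u)$, $\widetilde\nabla f(\bar x^K)\in\partial f(\bar x^K)$, $$\mathcal{L}(\bar x^K,u)-\mathcal{L}(x,\bar u^K)-\frac{1}{\alpha(K+1)}\left(\|x^0-x\|^2+\alpha^2\|u^0-u\|^2\right)=I_f+I_g-\mathcal{S}_1-\mathcal{S}_2,$$ where $$I_f=\tfrac1K\sum_{k=1}^K\big(f(\bar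 x^K)-f(x^k)+\langle\widetilde\nabla f(\bar x^K),x^k-\bar x^K\rangle\big)+\tfrac1K\sum_{k=1}^K\big(f(x^k)-f(x)+\langle\widetilde\nabla f(x^k),x-x^k\rangle\big),$$ $$I_g=\tfrac1K\sum_{k=1}^K\big(g(p^k)-g(\bar p^K)+\langle u^k,\bar p^K-p^k\rangle\big)+\tfrac1K\sum_{k=1}^K\big(g(p)-g(p^k)+\langle u,p^k-p\rangle\big),$$ $$\mathcal{S}_1=\tfrac{1}{\alpha(K+1)}\Big(\Big\|x^0-x-\tfrac{\alpha(K+1)}{2K}\sum_{k=1}^K v^k\Big\|^2+\alpha^2\Big\|u^0-u-\tfrac{K+1}{2K}\sum_{k=1}^K v^k\Big\|^2\Big),$$ $$\mathcal{S}_2=\tfrac{\alpha}{2K^2}\sum_{k=1}^K\sum_{l=1}^{k-1}\|v^k-v^l\|^2.$$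
   Context: $\langle\cdot,\cdot\rangle$ and $\|\cdot\|$ are the standard inner product and Euclidean norm on $\mathbb{R}^n$. $g^*(y)=\sup_x\{\langle y,x\rangle-g(x)\}$ is the Fenchel conjugate, $\partial$ the convex subdifferential, and $\mathrm{prox}_\varphi(x)=\arg\min_{y}\{\varphi(y)+\frac12\|y-x\|^2\}$. The Lagrangian is $\mathcal{L}(x,u)=f(x)+\langle u,x\rangle-g^*(u)$, with $\mathcal{L}(x,u)=+\infty$ if $x\notin\mathrm{dom}\, f$ and $\mathcal{L}(x,u)=-\infty$ if $x\in\mathrm{dom}\, f$, $u\notin\mathrm{dom}\, g^*$; if $x\notin\mathrm{dom}\, f$ both sides of the equality are read as $-\infty$. The iteration is the Douglas--Rachford splitting algorithm (variant DRS-$gf$) for minimizing $f+g$. *)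

(* Defs.v *)
From HB Require Import structures.
From mathcomp Require Export all_boot all_order all_algebra.
From mathcomp Require Export all_classical all_reals all_analysis.

Set Implicit Arguments.
Unset Strict Implicit.
Unset Printing Implicit Defensive.

Import Order.TTheory GRing.Theory Num.Theory.
Import numFieldNormedType.Exports.

Local Open Scope classical_set_scope.
Local Open Scope ring_scope.
Local Open Scope ereal_scope.

(* The library norm `|x| on row vectors is the sup norm, hence the Euclidean
   norm below; the topology of 'rV[R]_n is the same for both. *)
Definition inner (R : realType) (n : nat) (x y : 'rV[R]_n) : R :=
  (\sum_(i < n) x ord0 i * y ord0 i)%R.

Definition enorm (R : realType) (n : nat) (x : 'rV[R]_n) : R :=
  Num.sqrt (inner x x).

Definition epigraph (R : realType) (n : nat) (f : 'rV[R]_n -> \bar R) :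
  set ('rV[R]_n * R) := [set z | f z.1 <= z.2%:E].

Definition convex_efun (R : realType) (n : nat) (f : 'rV[R]_n -> \bar R) : Prop :=
  forall (x y : 'rV[R]_n) (t : R), (0 <= t <= 1)%R ->
    f (t *: x + (1 - t) *: y)%R <= t%:E * f x + (1 - t)%:E * f y.

(* Closed convex proper functions R^n -> R \cup {+oo}. *)
Definition ccp (R : realType) (n : nat) (f : 'rV[R]_n -> \bar R) : Prop :=
  [/\ forall x, f x != -oo, exists x, f x < +oo,
      convex_efun f & closed (epigraph f)].

Definition conjugate (R : realType) (n : nat) (g : 'rV[R]_n -> \bar R)
    (y : 'rV[R]_n) : \bar R :=
  ereal_sup [set (inner y x)%:E - g x | x in setT].

(* For proper phi this is empty at every x with phi x = +oo. *)
Definition subdifferential (R : realType) (n : nat) (phi : 'rV[R]_n -> \bar R)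
    (x : 'rV[R]_n) : set 'rV[R]_n :=
  [set s | forall y, phi x + (inner s (y - x)%R)%:E <= phi y].

Definition argmin (R : realType) (T : Type) (h : T -> \bar R) : set T :=
  [set y | forall z, h y <= h z].

(* The default value 0 is returned only if there is no minimizer. *)
Definition prox (R : realType) (n : nat) (phi : 'rV[R]_n -> \bar R)
    (x : 'rV[R]_n) : 'rV[R]_n :=
  xget 0%R (argmin (fun y => phi y + (2^-1 * enorm (y - x) ^+ 2)%:E)).

Definition lagrangian (R : realType) (n : nat) (f g : 'rV[R]_n -> \bar R)
    (x u : 'rV[R]_n) : \bar R :=
  if f x < +oo then
    if conjugate g u < +oo then f x + (inner u x)%:E - conjugate g u else -oo
  else +oo.

(* Main.v *)
From mathcomp Require Import finmap ring lra.
Require Import Defs.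

Set Implicit Arguments.
Unset Strict Implicit.
Unset Printing Implicit Defensive.

Import Order.TTheory GRing.Theory Num.Theory.
Import numFieldNormedType.Exports.

Local Open Scope classical_set_scope.
Local Open Scope ring_scope.
Local Open Scope ereal_scope.

(** The statement has an analytic and an algebraic half.

    Analytic half. A closed convex proper function [phi] decreases
    at most linearly at infinity ([ccp_linear_lower_bound]), so that its proximal
    objective has compact sublevel sets and attains its minimum; convexity then
    makes [(x - y) / lam] a subgradient of [phi] at the proximal point [y] of
    [lam * phi] at [x] ([prox_subgradient]). For the two proximal steps of the
    iteration these subgradients are exactly [ps k] and [gradf k]. The first
    step involves the conjugate of [g], which is itself closed convex proper
    ([conjugate_ccp]): its properness comes from a subgradient of [g], and a
    proximal point of [g] supplies one. The identity compares values of [g] and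
    of its conjugate, which requires the biconjugation equality
    [g p = <p, u> - g^* u] whenever [p] is a subgradient of [g^*] at [u].
    Instead of separating hyperplanes, [conjugate_subdifferentialK] uses the
    proximal points of [lam * g] at [p]: they converge to [p] as [lam] tends to
    0 and keep [g] below [<p, u> - g^* u], so closedness passes the bound on to
    [p].

    Algebraic half. All values involved being finite (except possibly [f x], in
    which case both sides are [-oo]), the function values in the four averaged
    gaps cancel, and since [ps k = xs k + alpha * vs k] the remaining inner
    products add up to those of [vs k] with
    [xs k + alpha * us k - (x + alpha * u)] ([sum_gaps]). The point
    [xs k + alpha * us k] moves by [- alpha * vs k] at each step, so it equals
    its initial value minus [alpha] times a prefix sum of the directions [vs];
    completing the squares in their total gives the right-hand side
    ([mean_inner_prefix]). *)

(** * The Euclidean structure on row vectors *)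

Section Euclidean.
Local Open Scope ring_scope.
Context {R : realType} {n : nat}.
Implicit Types (x y z : 'rV[R]_n) (a : R).

Lemma innerC x y : inner x y = inner y x.
Proof. by apply: eq_bigr => i _; rewrite mulrC. Qed.

Lemma innerDl x y z : inner (x + y) z = inner x z + inner y z.
Proof. by rewrite -big_split; apply: eq_bigr => i _; rewrite !mxE mulrDl. Qed.

Lemma innerZl a x y : inner (a *: x) y = a * inner x y.
Proof. by rewrite /inner mulr_sumr; apply: eq_bigr => i _; rewrite !mxE mulrA. Qed.

Lemma innerNl x y : inner (- x) y = - inner x y.
Proof. by rewrite -scaleN1r innerZl mulN1r. Qed.

Lemma innerDr x y z : inner x (y + z) = inner x y + inner x z.
Proof. by rewrite innerC innerDl !(innerC x). Qed.

Lemma innerZr a x y : inner x (a *: y) = a * inner x y.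
Proof. by rewrite innerC innerZl innerC. Qed.

Lemma innerNr x y : inner x (- y) = - inner x y.
Proof. by rewrite innerC innerNl innerC. Qed.

Lemma inner0l y : inner 0 y = 0.
Proof. by rewrite -(scale0r 0) innerZl mul0r. Qed.

Definition innerE :=
  (innerDl, innerDr, innerNl, innerNr, innerZl, innerZr).

Lemma inner_suml (r : seq nat) (F : nat -> 'rV[R]_n) y :
  inner (\sum_(k <- r) F k) y = \sum_(k <- r) inner (F k) y.
Proof.
by elim/big_rec2: _ => [|k a b _ <-]; rewrite ?inner0l ?innerDl.
Qed.

Lemma inner_sumr (r : seq nat) (F : nat -> 'rV[R]_n) y :
  inner y (\sum_(k <- r) F k) = \sum_(k <- r) inner y (F k).
Proof. by rewrite innerC inner_suml; apply: eq_bigr => k _; rewrite innerC. Qed.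

Lemma inner_ge0 x : 0 <= inner x x.
Proof. by apply: sumr_ge0 => i _; rewrite -expr2 sqr_ge0. Qed.

Lemma enorm_sqr x : enorm x ^+ 2 = inner x x.
Proof. by rewrite sqr_sqrtr// inner_ge0. Qed.

Lemma enorm_ge0 x : 0 <= enorm x.
Proof. exact: sqrtr_ge0. Qed.

Lemma enorm_le1 x : (enorm x <= 1) = (inner x x <= 1).
Proof.
by rewrite -enorm_sqr -(@ler_pXn2r _ 2) ?nnegrE ?enorm_ge0// expr1n.
Qed.

Lemma inner_sqrDZ x y a : inner (x + a *: y) (x + a *: y) =
  inner x x + 2 * a * inner x y + a ^+ 2 * inner y y.
Proof. rewrite !innerE (innerC y x); ring. Qed.

(** A substitute for the triangle inequality that stays with squared norms. *)
Lemma inner_sqrB x y z :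
  inner (y - z) (y - z) <= 2 * inner (y - x) (y - x) + 2 * inner (x - z) (x - z).
Proof.
have := inner_ge0 ((y - x) - (x - z)).
rewrite !innerE (innerC x y) (innerC z y) (innerC z x); lra.
Qed.

(** Boundedness and neighbourhoods in ['rV_n] refer to the sup norm [`|x|]; this
    comparison carries Euclidean bounds over to it. *)
Lemma normr_le_enorm x : `|x| <= enorm x.
Proof.
rewrite [leLHS]mx_normrE; apply: bigmax_le => [|[i j] _ /=]; first exact: enorm_ge0.
rewrite (ord1 i) -sqrtr_sqr ler_sqrt ?inner_ge0// /inner (bigD1 j)//= -expr2.
by rewrite lerDl sumr_ge0// => k _; rewrite -expr2 sqr_ge0.
Qed.

Lemma continuous_inner (T : topologicalType) (p q : T -> 'rV[R]_n) :
  continuous p -> continuous q -> continuous (fun t => inner (p t) (q t)).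
Proof.
move=> cp cq t; rewrite /inner.
apply: (@continuous_big _ _ _ _ _ add_continuous _ _
  (fun i t => p t ord0 i * q t ord0 i)) => i _ {}t; apply: cvgM.
- by apply: (@continuous_comp _ _ _ p (fun M => M ord0 i) t (cp t));
     exact: coord_continuous.
- by apply: (@continuous_comp _ _ _ q (fun M => M ord0 i) t (cq t));
     exact: coord_continuous.
Qed.

End Euclidean.

(** * Minima of closed functions *)

Section Minima.
Context {R : realType} {n : nat}.

(** Were there no minimizer, the open sets [{y | h z < h y}], [z] in [K], would
    cover [K]; the value least among finitely many such [z] defeats any finite
    subcover. *)
Lemma compact_min (K : set 'rV[R]_n) (h : 'rV[R]_n -> \bar R) :
  compact K -> (forall y, h y != -oo) ->
  (forall r : R, closed [set y | h y <= r%:E]) ->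
  (exists2 y, K y & h y < +oo) ->
  exists2 y, K y & forall z, K z -> h y <= h z.
Proof.
move=> cK hNy hcl [y0 Ky0 hy0]; apply: contrapT => nomin.
have lower y : K y -> exists2 z, K z & h z < h y.
  move=> Ky; apply: contrapT => nz; apply: nomin; exists y => // z Kz.
  by rewrite leNgt; apply/negP => hzy; apply: nz; exists z.
pose U z := [set y | h z < h y].
move: cK; rewrite compact_cover.
move=> /(_ _ [set z | K z /\ h z < +oo] U) [].
- move=> z /= [_ hz].
  have hzE : h z = (fine (h z))%:E.
    by rewrite fineK// fin_numElt ltNye hNy.
  have -> : U z = ~` [set y | h y <= (fine (h z))%:E].
    rewrite /U -hzE; apply/seteqP; split => y /=; first by rewrite ltNge => /negP.
    by rewrite ltNge => /negP.
  by rewrite openC; exact: hcl.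
- move=> y /lower[z Kz hzy]; exists z => //; split => //.
  by rewrite (lt_le_trans hzy)// leey.
move=> D sD covD.
have [z0 Dz0 _] := covD _ Ky0.
case: (@Order.TotalTheory.arg_minP _ _ D (FSetSub Dz0) xpredT (h \o val)) => //.
move=> z _ zmin.
have /= := sD _ (valP z); rewrite inE => -[Kz _].
have [w Dw] := covD _ Kz.
by rewrite /U/= ltNge (zmin (FSetSub Dw)).
Qed.

Lemma bounded_enorm (x0 : 'rV[R]_n) (M : R) :
  bounded_set [set y : 'rV[R]_n | (enorm (y - x0) <= M)%R].
Proof.
exists (M + `|x0|)%R; split; first exact: num_real.
move=> N MN y /= yM; rewrite -(subrK x0 y).
apply: (le_trans (ler_normD _ _)); apply: ltW; apply: le_lt_trans MN.
by rewrite lerD2r (le_trans (normr_le_enorm _)).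
Qed.

Lemma continuous_sqdist (x0 : 'rV[R]_n) :
  continuous (fun y : 'rV[R]_n => inner (y - x0) (y - x0))%R.
Proof.
have c : continuous (fun y : 'rV[R]_n => y - x0)%R.
  move=> y; apply: (@continuousB R 'rV[R]_n 'rV[R]_n id (cst x0)).
  - by move=> A.
  - exact: cst_continuous.
exact: (continuous_inner c c).
Qed.

Lemma compact_enorm (x0 : 'rV[R]_n) :
  compact [set y : 'rV[R]_n | (enorm (y - x0) <= 1)%R].
Proof.
apply: bounded_closed_compact; first exact: bounded_enorm.
have -> : [set y : 'rV[R]_n | (enorm (y - x0) <= 1)%R] =
    (fun y : 'rV[R]_n => inner (y - x0) (y - x0))%R @^-1` [set r | r <= 1]%R.
  by apply/seteqP; split => y /=; rewrite enorm_le1.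
apply: preimage_closed (@closed_le _ _) => y _.
exact: continuous_sqdist.
Qed.

Section ClosedConvex.
Variable phi : 'rV[R]_n -> \bar R.
Hypothesis phi_ccp : ccp phi.

Lemma ccp_fineK x : phi x < +oo -> phi x = (fine (phi x))%:E.
Proof.
by case: phi_ccp => phiNy _ _ _ phix; rewrite fineK// fin_numElt ltNye phiNy.
Qed.

Lemma ccp_subdifferential_fin x s : subdifferential phi x s ->
  phi x = (fine (phi x))%:E.
Proof.
case: phi_ccp => _ [y phiy] _ _ /(_ y) sub; apply: ccp_fineK.
rewrite ltey; apply/eqP => e; move: sub; rewrite e addye// leye_eq => /eqP e'.
by rewrite e' ltxx in phiy.
Qed.

Lemma continuous_graph (q : 'rV[R]_n -> R) :
  continuous q -> continuous (fun y : 'rV[R]_n => (y, q y)).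
Proof.
move=> cq y; have F : Filter (nbhs y) by exact: nbhs_filter.
apply: (@cvg_pair _ _ _ (nbhs y) (nbhs y) (nbhs (q y)) F _ _ id q).
  by move=> A.
exact: cq.
Qed.

(** Closedness of the epigraph, pulled back along the graph of [q]; a continuous
    [q] instead of a constant one covers sublevel sets of [phi] plus a
    continuous function. *)
Lemma ccp_closed_sublevel (q : 'rV[R]_n -> R) : continuous q ->
  closed [set y | phi y <= (q y)%:E].
Proof.
case: phi_ccp => _ _ _ phicl cq.
have -> : [set y | phi y <= (q y)%:E] = (fun y => (y, q y)) @^-1` epigraph phi.
  by [].
by apply: preimage_closed phicl => y _; exact: continuous_graph.
Qed.

Lemma ccp_convex_fine x y t : phi x < +oo -> phi y < +oo -> (0 <= t <= 1)%R ->
  phi (t *: x + (1 - t) *: y)%R <=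
    (t * fine (phi x) + (1 - t) * fine (phi y))%:E.
Proof.
case: (phi_ccp) => _ _ cvx _ phix phiy /cvx /le_trans; apply.
by rewrite {1}(ccp_fineK phix) {1}(ccp_fineK phiy) -!EFinM -EFinD.
Qed.

(** On the unit ball around a point of the domain [phi] has a minimum; along a
    ray leaving the ball, convexity lets [phi] decrease at most linearly. *)
Lemma ccp_linear_lower_bound (x0 : 'rV[R]_n) : phi x0 < +oo ->
  exists2 C : R, (0 <= C)%R &
    forall y, (- (C * (1 + enorm (y - x0))))%:E <= phi y.
Proof.
move=> phi0; have [phiNy _ _ _] := phi_ccp.
have [y1 /= _ min1] : exists2 y, [set y : 'rV[R]_n | (enorm (y - x0) <= 1)%R] y &
    forall z, [set y : 'rV[R]_n | (enorm (y - x0) <= 1)%R] z -> phi y <= phi z.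
  apply: compact_min => //; first exact: compact_enorm.
    by move=> r; apply: (@ccp_closed_sublevel (cst r)); exact: cst_continuous.
  exists x0 => //=.
  by rewrite subrr /enorm inner0l sqrtr0.
have phi1 : phi y1 < +oo.
  apply: le_lt_trans phi0; apply: min1 => /=.
  by rewrite subrr /enorm inner0l sqrtr0.
move: min1; rewrite (ccp_fineK phi1) => min1.
set m := fine (phi y1) in min1; set c := fine (phi x0).
have mC : (- (`|m| + `|c|) <= m)%R.
  have := ler_norm (- m)%R; rewrite normrN; have := normr_ge0 c; lra.
exists (`|m| + `|c|)%R; first by rewrite addr_ge0.
move=> y; have [phiy|] := boolP (phi y < +oo); last first.
  by rewrite -leNgt leye_eq => /eqP ->; rewrite leey.
set s := enorm (y - x0); have s0 : (0 <= s)%R by exact: enorm_ge0.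
have C0 : (0 <= `|m| + `|c|)%R by rewrite addr_ge0.
have [s1|s1] := leP s 1%R.
  apply: le_trans (min1 y s1); rewrite lee_fin; nra.
have s_gt0 : (0 < s)%R by lra.
have s_neq0 : s != 0%R by rewrite gt_eqF.
have sV : (0 <= s^-1 <= 1)%R by rewrite invr_ge0 s0/= invf_le1// ltW.
set z := (s^-1 *: y + (1 - s^-1) *: x0)%R.
have z1 : (enorm (z - x0) <= 1)%R.
  have -> : (z - x0 = s^-1 *: (y - x0))%R by apply/rowP => i; rewrite !mxE; ring.
  rewrite enorm_le1 innerZl innerZr -enorm_sqr -/s.
  have -> : (s^-1 * (s^-1 * s ^+ 2) = 1)%R by field.
  by rewrite lexx.
have := le_trans (min1 _ z1) (ccp_convex_fine phiy phi0 sV).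
rewrite (ccp_fineK phiy) !lee_fin -/c => le1.
have : (s * m <= fine (phi y) + (s - 1) * c)%R.
  apply: le_trans (ler_wpM2l s0 le1) _; rewrite le_eqVlt; apply/orP; left.
  by apply/eqP; field.
have := ler_norm c; have := ler_norm (- m)%R; rewrite normrN.
nra.
Qed.

End ClosedConvex.
End Minima.

(** * Proximal points *)

Section Proximal.
Context {R : realType} {n : nat}.

Lemma quadratic_bound (s A B : R) : (0 <= s)%R -> (0 <= A)%R -> (0 <= B)%R ->
  (s ^+ 2 <= A + B * s)%R -> (s <= A + B + 1)%R.
Proof. move=> s0 A0 B0 sAB; rewrite leNgt; apply/negP => lts; nra. Qed.

Lemma continuous_affine (T : topologicalType) (q : T -> R) (a b c : R) :
  continuous q -> continuous (fun y => a * (b - c * q y))%R.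
Proof.
move=> cq y; apply: cvgM; first exact: cvg_cst.
apply: cvgB; first exact: cvg_cst.
by apply: cvgM; [exact: cvg_cst | exact: cq].
Qed.

Lemma le_pmulD_fin (lam q r : R) (a : \bar R) : (0 < lam)%R -> a != -oo ->
  (lam%:E * a + q%:E <= r%:E) = (a <= (lam^-1 * (r - q))%:E).
Proof.
move=> lam0; case: a => [a| |]//= _; last by rewrite gt0_muley ?lte_fin.
by rewrite -EFinM -EFinD !lee_fin ler_pdivlMl// lerBrDr.
Qed.

Variable phi : 'rV[R]_n -> \bar R.
Hypothesis phi_ccp : ccp phi.
Variable lam : R.
Hypothesis lam_gt0 : (0 < lam)%R.

(** The at most linear decrease of [phi] is dominated by the quadratic term, so
    the sublevel sets of the proximal objective are compact. *)
Lemma prox_argmin (x : 'rV[R]_n) :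
  argmin (fun y => lam%:E * phi y + (2^-1 * enorm (y - x) ^+ 2)%:E)
    (prox (fun y => lam%:E * phi y) x).
Proof.
apply: xgetPex.
have [phiNy [x0 phi0] _ _] := phi_ccp.
pose q y : R := (2^-1 * enorm (y - x) ^+ 2)%R.
pose h y := lam%:E * phi y + (q y)%:E.
have hle r y : (h y <= r%:E) = (phi y <= (lam^-1 * (r - q y))%:E).
  exact: le_pmulD_fin.
have hcl r : closed [set y | h y <= r%:E].
  under eq_set do rewrite hle.
  apply: ccp_closed_sublevel => //.
  under eq_fun do rewrite /q enorm_sqr.
  apply: continuous_affine; exact: continuous_sqdist.
have hNy y : h y != -oo.
  by rewrite /h; move: (phiNy y); case: (phi y) => //= _; rewrite gt0_muley ?lte_fin.
pose c : R := (lam * fine (phi x0) + q x0)%R.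
have hx0 : h x0 = c%:E by rewrite /h (ccp_fineK phi_ccp phi0) -EFinM -EFinD.
pose K := [set y | h y <= c%:E].
have Kx0 : K x0 by rewrite /K /= hx0.
have cK : compact K.
  apply: bounded_closed_compact; last exact: hcl.
  have [C C0 phiC] := ccp_linear_lower_bound phi_ccp phi0.
  pose D := inner (x - x0)%R (x - x0)%R.
  pose A : R := (4 * `|c| + 4 * (lam * C) + 2 * D)%R.
  have lC : (0 <= lam * C)%R by rewrite mulr_ge0// ltW.
  have D0 : (0 <= D)%R by exact: inner_ge0.
  have [M [M_real KM]] := bounded_enorm x0 (A + 4 * (lam * C) + 1)%R.
  exists M; split => // N MN y Ky; apply: (KM N MN) => /=.
  have phiy : phi y < +oo.
    by move: Ky; rewrite /K/= hle => /le_lt_trans; apply; exact: ltry.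
  move: (phiC y) Ky; rewrite /K /= /h (ccp_fineK phi_ccp phiy) -EFinM -EFinD !lee_fin.
  rewrite /q enorm_sqr => low up.
  set s := enorm (y - x0)%R in low *.
  have s0 : (0 <= s)%R by exact: enorm_ge0.
  have c0 := ler_norm c; have c1 := normr_ge0 c.
  apply: quadratic_bound => //; [rewrite /A; lra | lra |].
  have := inner_sqrB x y x0; rewrite -/D -enorm_sqr -/s.
  have := ler_wpM2l (ltW lam_gt0) low.
  rewrite /A mulrN mulrA mulrDr mulr1; nra.
have [|y Ky ymin] := compact_min cK hNy hcl.
  by exists x0 => //; rewrite hx0 ltry.
exists y => z; have [hz|hz] := leP (h z) c%:E; first exact: ymin.
exact: (le_trans Ky (ltW hz)).
Qed.

(** Comparing the minimizer [y] with [y + t (z - y)] and letting [t] tend to 0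
    removes the quadratic term. *)
Lemma prox_subgradient (x : 'rV[R]_n) :
  let y := prox (fun y => lam%:E * phi y) x in
  subdifferential phi y (lam^-1 *: (x - y))%R.
Proof.
move=> y z; have := prox_argmin x; rewrite -/y => ymin.
have [phiNy [x0 phi0] _ _] := phi_ccp.
have phiy : phi y < +oo.
  have := ymin x0; rewrite (ccp_fineK phi_ccp phi0) -EFinM -EFinD.
  by rewrite le_pmulD_fin// => /le_lt_trans; apply; exact: ltry.
have [phiz|] := boolP (phi z < +oo); last first.
  by rewrite -leNgt leye_eq => /eqP ->; rewrite leey.
have key t : (0 < t <= 1)%R -> (0 <= lam * (fine (phi z) - fine (phi y)) +
    inner (y - x) (z - y) + t * inner (z - y) (z - y))%R.
  move=> /andP[t0 t1].
  have t01 : (0 <= t <= 1)%R by rewrite ltW.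
  have cvx := ccp_convex_fine phi_ccp phiz phiy t01.
  set w := (t *: z + (1 - t) *: y)%R in cvx.
  have phiw : phi w < +oo by apply: le_lt_trans cvx (ltry _).
  have := ymin w; rewrite !enorm_sqr (_ : w - x = (y - x) + t *: (z - y))%R; last first.
    by apply/rowP => i; rewrite !mxE; ring.
  move: cvx; rewrite (ccp_fineK phi_ccp phiw) (ccp_fineK phi_ccp phiy).
  rewrite -!EFinM -!EFinD !lee_fin /=.
  set a := (y - x)%R; set b := (z - y)%R.
  rewrite inner_sqrDZ => cvx le1.
  have := ler_wpM2l (ltW lam_gt0) cvx; have := inner_ge0 b => b0 lcvx.
  have : (0 <= t * (lam * (fine (phi z) - fine (phi y)) + inner a b
      + t * inner b b))%R.
    nra.
  by rewrite pmulr_rge0.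
rewrite (ccp_fineK phi_ccp phiz) (ccp_fineK phi_ccp phiy) -EFinD lee_fin.
have lim0 : (0 <= lam * (fine (phi z) - fine (phi y)) + inner (y - x) (z - y))%R.
  set A := (lam * _ + _)%R in key *; set B := inner (z - y) _ in key.
  have B0 : (0 <= B)%R by exact: inner_ge0.
  rewrite leNgt; apply/negP => A0.
  (* This t lies in ]0, 1] and satisfies t * B <= - A / 2. *)
  pose t : R := ((- A) / (2 * (B - A)))%R.
  have BA : (0 < 2 * (B - A))%R by lra.
  have tE : (t * (2 * (B - A)) = - A)%R by rewrite /t divfK// gt_eqF.
  have t0 : (0 < t)%R by rewrite divr_gt0//; lra.
  have t1 : (t <= 1)%R by rewrite ler_pdivrMr//; lra.
  have := key t; rewrite t0 t1 => /(_ isT); nra.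
rewrite innerZl -(ler_pM2l lam_gt0) mulrDr mulrA divff ?gt_eqF// mul1r.
have -> : (x - y = - (y - x))%R by rewrite opprB.
rewrite innerNl; nra.
Qed.

End Proximal.

(** * Conjugate functions *)

Section Conjugate.
Context {R : realType} {n : nat}.
Variable g : 'rV[R]_n -> \bar R.
Hypothesis g_ccp : ccp g.

Lemma fenchel_young (x y : 'rV[R]_n) : (inner y x)%:E - g x <= conjugate g y.
Proof. by apply: ereal_sup_ubound; exists x. Qed.

Lemma conjugate_le (y : 'rV[R]_n) (b : \bar R) :
  (forall x, g x < +oo -> (inner y x - fine (g x))%:E <= b) ->
  conjugate g y <= b.
Proof.
move=> yb; apply: ge_ereal_sup => _ [x _ <-].
have [gx|] := boolP (g x < +oo).
  by rewrite (ccp_fineK g_ccp gx) -EFinB; exact: yb.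
by rewrite -leNgt leye_eq => /eqP ->; rewrite addeNy leNye.
Qed.

Lemma conjugate_subdifferential_le (x s : 'rV[R]_n) : subdifferential g x s ->
  conjugate g s <= (inner s x - fine (g x))%:E.
Proof.
move=> sub; apply: conjugate_le => z gz; move: (sub z).
rewrite (ccp_fineK g_ccp gz) (ccp_subdifferential_fin g_ccp sub) -EFinD !lee_fin.
rewrite /= !innerE; lra.
Qed.

(** Convexity and closedness are those of a supremum of affine functions. The
    conjugate is somewhere finite because a proximal point of [g] provides a
    subgradient of [g]. *)
Lemma conjugate_ccp : ccp (conjugate g).
Proof.
have [gNy [x0 g0] _ _] := g_ccp; split.
- move=> y; rewrite gt_eqF//; apply: lt_le_trans (fenchel_young x0 y).
  by rewrite (ccp_fineK g_ccp g0) -EFinB ltNyr.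
- have sub := prox_subgradient g_ccp (@ltr01 R) 0%R.
  eexists; apply: le_lt_trans (conjugate_subdifferential_le sub) _.
  exact: ltry.
- move=> y z t /andP[t0 t1]; apply: conjugate_le => x gx.
  have le_scale (a : R) w : (0 <= a)%R ->
      (a * (inner w x - fine (g x)))%:E <= a%:E * conjugate g w.
    move=> a0; rewrite EFinM; apply: lee_wpmul2l; first by rewrite lee_fin.
    by rewrite EFinB -ccp_fineK//; exact: fenchel_young.
  have t1' : (0 <= 1 - t)%R by rewrite subr_ge0.
  apply: le_trans (leeD (le_scale _ y t0) (le_scale _ z t1')).
  rewrite -EFinD lee_fin !innerE; lra.
- have -> : epigraph (conjugate g) = \bigcap_(x in [set x | g x < +oo])
      (fun z : 'rV[R]_n * R => inner z.1 x - z.2)%R @^-1`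
        [set r | r <= fine (g x)]%R.
    apply/seteqP; split => [[y r] /= yr x /= gx|[y r] /= yr].
      have := le_trans (fenchel_young x y) yr.
      by rewrite (ccp_fineK g_ccp gx) -EFinB lee_fin /= lerBlDr addrC -lerBlDr.
    rewrite /epigraph /=; apply: conjugate_le => x gx; have /= := yr x gx.
    by rewrite lee_fin lerBlDr addrC lerBlDr.
  apply: closed_bigI => x _.
  apply: preimage_closed (@closed_le _ _) => z _.
  apply: cvgB; last exact: cvg_snd.
  apply: (@continuous_inner _ _ _ fst (cst x)).
    by move=> w; exact: cvg_fst.
  exact: cst_continuous.
Qed.

(** With [y] the proximal point of [lam g] at [p] and [s = (p - y) / lam], which
    is a subgradient of [g] at [y], the hypothesis yields
    [g y + |p - y|^2 / lam <= <p, u> - g^* u]. As [lam] tends to 0, [y] tends to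
    [p], and closedness of the epigraph gives the upper bound on [g p]. *)
Lemma conjugate_subdifferentialK (p u : 'rV[R]_n) :
  subdifferential (conjugate g) u p ->
  g p = (inner p u - fine (conjugate g u))%:E.
Proof.
move=> sub; have uE := ccp_subdifferential_fin conjugate_ccp sub.
set M := (inner p u - fine (conjugate g u))%R.
have prox_bound (lam : R) : (0 < lam)%R -> exists2 y,
    g y <= M%:E & (lam * fine (g y) + inner (p - y) (p - y) <= lam * M)%R.
  move=> lam0; set y := prox (fun y => lam%:E * g y) p.
  have subs : subdifferential g y (lam^-1 *: (p - y))%R.
    exact: prox_subgradient.
  set s := (lam^-1 *: (p - y))%R in subs.
  have yE := ccp_subdifferential_fin g_ccp subs.
  have := le_trans (sub s) (conjugate_subdifferential_le subs).
  rewrite uE -EFinD lee_fin /s => le1.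
  have le2 : (fine (g y) + lam^-1 * inner (p - y) (p - y) <= M)%R.
    move: le1; rewrite /M !innerE (innerC y p); lra.
  exists y.
    rewrite yE lee_fin; apply: le_trans le2; rewrite lerDl mulr_ge0 ?inner_ge0//.
    by rewrite invr_ge0 ltW.
  have := ler_wpM2l (ltW lam0) le2.
  by rewrite mulrDr mulrA divff ?gt_eqF// mul1r.
apply/eqP; rewrite eq_le; apply/andP; split; last first.
  move: (fenchel_young p u); rewrite uE.
  case: g_ccp => gNy _ _ _; move: (gNy p); case: (g p) => [r| |]// _.
  - by rewrite -EFinB !lee_fin /M innerC; lra.
  - by rewrite leey.
have [_ [x0 g0] _ _] := g_ccp.
have [C C0 gC] := ccp_linear_lower_bound g_ccp g0.
apply: contrapT => npM.
have : nbhs p [set y | ~ g y <= M%:E].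
  have cM : closed [set y | g y <= M%:E].
    by apply: (@ccp_closed_sublevel _ _ _ g_ccp (cst M)); exact: cst_continuous.
  by apply: open_nbhs_nbhs; split => //; rewrite -[X in open X]/(~` _) openC.
move=> /nbhs_normP[e /= e0 pe].
pose D := inner (p - x0)%R (p - x0)%R.
have D0 : (0 <= D)%R by exact: inner_ge0.
have M0 : (0 <= `|M|)%R by [].
have M1 := ler_norm M.
(* Chosen so that M - g y <= A + 2 C |p - y|^2 wherever g y is finite. *)
pose A : R := (`|M| + 2 * C + 2 * C * D)%R.
have CD : (0 <= C * D)%R by rewrite mulr_ge0.
have A0 : (0 <= A)%R by rewrite /A; nra.
(* Small enough for 4 lam C <= 1 and 4 lam A < e^2, whence |p - y| < e. *)
pose lam : R := (Num.min 1 (e ^+ 2) / (4 * (A + C + 1)))%R.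
have den0 : (0 < 4 * (A + C + 1))%R by lra.
have min0 : (0 < Num.min 1 (e ^+ 2) :> R)%R by rewrite lt_min ltr01 exprn_gt0.
have lam0 : (0 < lam)%R by rewrite divr_gt0.
have lamE : (lam * (4 * (A + C + 1)) = Num.min 1 (e ^+ 2))%R.
  by rewrite /lam divfK// gt_eqF.
have lam1 : (lam * (4 * (A + C + 1)) <= 1)%R by rewrite lamE ge_min lexx.
have lame : (lam * (4 * (A + C + 1)) <= e ^+ 2)%R.
  by rewrite lamE ge_min lexx orbT.
have [y yM ylam] := prox_bound lam lam0.
have gy : g y < +oo by apply: le_lt_trans yM (ltry _).
apply: (pe y) yM => /=; apply: le_lt_trans (normr_le_enorm _) _.
rewrite -(@ltr_pXn2r _ 2) ?nnegrE ?enorm_ge0 ?ltW// enorm_sqr.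
have := gC y; rewrite (ccp_fineK g_ccp gy) lee_fin.
have := inner_sqrB p y x0.
have -> : inner (y - p)%R (y - p)%R = inner (p - y)%R (p - y)%R.
  by rewrite -(opprB p y) innerNl innerNr opprK.
rewrite -/D -enorm_sqr; set s := enorm (y - x0).
set q := inner (p - y)%R _ in ylam * => sq low.
have q0 : (0 <= q)%R by exact: inner_ge0.
have low' : (M - fine (g y) <= A + 2 * C * q)%R.
  rewrite /A; have : (C * (1 + s) <= C * (2 + 2 * q + 2 * D))%R.
    by apply: ler_wpM2l => //; nra.
  nra.
have lamA : (0 <= lam * A)%R by rewrite mulr_ge0// ltW.
have lamC : (0 <= lam * C)%R by rewrite mulr_ge0// ltW.
have lamCq : (4 * (lam * C) * q <= q)%R by apply: ler_piMl => //; lra.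
have := ler_wpM2l (ltW lam0) low'; lra.
Qed.

Lemma conjugate_subdifferential_eq (p u : 'rV[R]_n) :
  subdifferential (conjugate g) u p ->
  g p = (fine (g p))%:E /\ conjugate g u = (inner p u - fine (g p))%:E.
Proof.
move=> sub; rewrite (conjugate_subdifferentialK sub); split => //=.
by rewrite (ccp_subdifferential_fin conjugate_ccp sub) /= subKr.
Qed.

End Conjugate.

(** * The algebra of the ergodic gap *)

Section Gap.
Local Open Scope ring_scope.
Context {R : realType} {n : nat}.
Implicit Types v : nat -> 'rV[R]_n.

(** The prefix sums include the diagonal [j = k]; by symmetry, twice the sum over
    [j <= k] is the sum over all pairs plus the diagonal. *)
Lemma sum_inner_prefix v K :
  2 * \sum_(1 <= k < K.+1) inner (v k) (\sum_(1 <= j < k.+1) v j) =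
  inner (\sum_(1 <= k < K.+1) v k) (\sum_(1 <= k < K.+1) v k) +
  \sum_(1 <= k < K.+1) inner (v k) (v k).
Proof.
elim: K => [|K IH]; first by rewrite !big_geq// inner0l; ring.
rewrite [in LHS]big_nat_recr//= mulrDr IH.
rewrite [\sum_(1 <= k < K.+2) inner _ _]big_nat_recr//=.
rewrite [\sum_(1 <= k < K.+2) v k]big_nat_recr//=.
set V := \sum_(_ <= _ < _) v _; rewrite !(innerDl, innerDr) (innerC V); ring.
Qed.

(** Lagrange's identity for the dispersion of a family of vectors. *)
Lemma sum_pairwise_sqdist v K :
  \sum_(1 <= k < K.+1) \sum_(1 <= l < k) inner (v k - v l) (v k - v l) =
  K%:R * (\sum_(1 <= k < K.+1) inner (v k) (v k)) -
  inner (\sum_(1 <= k < K.+1) v k) (\sum_(1 <= k < K.+1) v k).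
Proof.
elim: K => [|K IH]; first by rewrite !big_geq// inner0l; ring.
rewrite [LHS]big_nat_recr//= IH.
rewrite [\sum_(1 <= k < K.+2) inner _ _]big_nat_recr//=.
rewrite [\sum_(1 <= k < K.+2) v k]big_nat_recr//=.
rewrite [X in _ + X = _](eq_bigr (fun l => inner (v K.+1) (v K.+1)
    + (inner (v l) (v l) - 2 * inner (v K.+1) (v l)))); last first.
  by move=> l _; rewrite !innerE (innerC (v l) (v K.+1)); ring.
rewrite big_split /= sumr_const_nat subn1 /= sumrB -mulr_sumr -inner_sumr.
set V := \sum_(_ <= _ < _) v _; rewrite !(innerDl, innerDr) (innerC V).
rewrite -natr1 -mulr_natl; ring.
Qed.

(** A completion of squares in the total [V] of the directions: the terms in
    [inner V V] left by the two squares and by the pairwise distances cancel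
    those produced by the prefix sums. *)
Lemma mean_inner_prefix v K (a : R) (x0 u0 x u : 'rV[R]_n) :
  0 < a -> (0 < K)%N ->
  K%:R^-1 * (\sum_(1 <= k < K.+1) inner (v k)
    (x0 + a *: u0 - a *: (\sum_(1 <= j < k.+1) v j) - (x + a *: u))) =
  (a * K.+1%:R)^-1 * (enorm (x0 - x) ^+ 2 + a ^+ 2 * enorm (u0 - u) ^+ 2)
  - (a * K.+1%:R)^-1 *
     (enorm (x0 - x - (a * K.+1%:R / (2 * K%:R)) *:
        \sum_(1 <= k < K.+1) v k) ^+ 2 +
      a ^+ 2 * enorm (u0 - u - (K.+1%:R / (2 * K%:R)) *:
        \sum_(1 <= k < K.+1) v k) ^+ 2)
  - a / (2 * K%:R ^+ 2) *
     \sum_(1 <= k < K.+1) \sum_(1 <= l < k) enorm (v k - v l) ^+ 2.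
Proof.
move=> a0 K0.
have aN0 : a != 0 by rewrite gt_eqF.
have KN0 : K%:R != 0 :> R by rewrite pnatr_eq0 -lt0n.
have K1N0 : K.+1%:R != 0 :> R by rewrite pnatr_eq0.
rewrite (eq_bigr (fun k => inner (v k) ((x0 - x) + a *: (u0 - u))
    - a * inner (v k) (\sum_(1 <= j < k.+1) v j))); last first.
  by move=> k _; rewrite -innerZr -innerNr -innerDr; congr inner;
     apply/rowP => i; rewrite !mxE; ring.
rewrite sumrB -mulr_sumr -inner_suml.
under [\sum_(1 <= k < K.+1) \sum_(1 <= l < k) _]eq_bigr do
  under eq_bigr do rewrite enorm_sqr.
have sqrBZ c (y z : 'rV[R]_n) : inner (y - c *: z) (y - c *: z) =
    inner y y - 2 * c * inner y z + c ^+ 2 * inner z z.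
  by rewrite -scaleNr inner_sqrDZ; ring.
rewrite sum_pairwise_sqdist !enorm_sqr !sqrBZ.
have Q2 := sum_inner_prefix v K.
set V := \sum_(1 <= k < K.+1) v k in Q2 *.
set W := \sum_(1 <= k < K.+1) inner (v k) (v k) in Q2 *.
set Q := \sum_(1 <= k < K.+1) inner (v k) (\sum_(_ <= _ < _) _) in Q2 *.
have -> : Q = (inner V V + W) / 2 by lra.
set b := x0 - x; set c := u0 - u.
rewrite innerDr innerZr (innerC V b) (innerC V c).
move: KN0 K1N0; rewrite -natr1 => KN0 K1N0.
by field; rewrite aN0 KN0 K1N0.
Qed.

(** Substituting the relation between [ps k] and [xs k] in the four gaps leaves,
    for each [k], the inner product on the right-hand side and terms whose sum
    depends on the averages only; [F k] and [G k] occur with both signs. *)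
Lemma sum_gaps K (a : R) (xs us gr ps : nat -> 'rV[R]_n) (F G : nat -> R)
    (x u pb p gb : 'rV[R]_n) (fb fx gpb gp : R) :
  (0 < K)%N ->
  (forall k, (0 < k)%N -> ps k = xs k + a *: (gr k + us k)) ->
  let xbar := K%:R^-1 *: \sum_(1 <= k < K.+1) xs k in
  let ubar := K%:R^-1 *: \sum_(1 <= k < K.+1) us k in
  (K%:R^-1 * (\sum_(1 <= k < K.+1) (fb - F k + inner gb (xs k - xbar))) +
   K%:R^-1 * (\sum_(1 <= k < K.+1) (F k - fx + inner (gr k) (x - xs k)))) +
  (K%:R^-1 * (\sum_(1 <= k < K.+1) (G k - gpb + inner (us k) (pb - ps k))) +
   K%:R^-1 * (\sum_(1 <= k < K.+1) (gp - G k + inner u (ps k - p)))) =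
  (fb + inner u xbar - (inner p u - gp))
  - (fx + inner ubar x - (inner pb ubar - gpb))
  - K%:R^-1 * (\sum_(1 <= k < K.+1)
      inner (gr k + us k) (xs k + a *: us k - (x + a *: u))).
Proof.
move=> K0 psE xbar ubar.
have KN0 : K%:R != 0 :> R by rewrite pnatr_eq0 -lt0n.
have xsum : \sum_(1 <= k < K.+1) xs k = K%:R *: xbar.
  by rewrite /xbar scalerA divff// scale1r.
have usum : \sum_(1 <= k < K.+1) us k = K%:R *: ubar.
  by rewrite /ubar scalerA divff// scale1r.
clearbody xbar ubar.
apply/eqP; rewrite eq_sym subr_eq -!mulrDr -!big_split /=; apply/eqP.
have [e eE] : exists e, e = fb - fx + gp - gpb - inner gb xbar - inner u p.
  by eexists.
rewrite (eq_big_nat _ _ (F2 := fun k =>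
    e + inner (gb + u) (xs k) + inner (us k) (pb - x))); last first.
  move=> k /andP[k1 _]; rewrite psE// eE !innerE.
  rewrite (innerC u (gr k)) (innerC u (us k)) (innerC (us k) (gr k)); ring.
rewrite !big_split /= sumr_const_nat subn1 /= -inner_sumr -inner_suml xsum usum.
rewrite !innerE -(mulr_natl e) eE (innerC p) (innerC pb).
by field.
Qed.

End Gap.

(** * The primal-dual gap of the iteration *)

Lemma sum_ninfty (R : realType) (K : nat) : (0 < K)%N ->
  \sum_(1 <= k < K.+1) (-oo : \bar R) = -oo.
Proof. by case: K => // K _; rewrite big_nat_recr//= addeNy. Qed.

Theorem proposition3p1 (R : realType) (n : nat) (f g : 'rV[R]_n -> \bar R)
  (f_ccp : ccp f) (g_ccp : ccp g)
  (saddle : exists xstar ustar : 'rV[R]_n,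
    [set (s + ustar)%R | s in subdifferential f xstar] 0%R /\
    [set (s - xstar)%R | s in subdifferential (conjugate g) ustar] 0%R)
  (alpha : R) (alpha_gt0 : (0 < alpha)%R)
  (xs us : nat -> 'rV[R]_n)
  (us_step : forall k : nat, us k.+1 =
    prox (fun y => (alpha^-1)%:E * conjugate g y) (us k + alpha^-1 *: xs k)%R)
  (xs_step : forall k : nat, xs k.+1 =
    prox (fun y => alpha%:E * f y) (xs k - alpha *: (2 *: us k.+1 - us k))%R) :
  let ps (k : nat) : 'rV[R]_n :=
    (alpha *: us k.-1 + xs k.-1 - alpha *: us k)%R in
  let gradf (k : nat) : 'rV[R]_n :=
    (alpha^-1 *: (xs k.-1 - alpha *: (2 *: us k - us k.-1) - xs k))%R in
  let vs (k : nat) : 'rV[R]_n := (gradf k + us k)%R in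
  (forall k : nat, (1 <= k)%N ->
    subdifferential (conjugate g) (us k) (ps k) /\
    subdifferential f (xs k) (gradf k)) /\
  forall K : nat, (1 <= K)%N ->
  let xbar : 'rV[R]_n := (K%:R^-1 *: \sum_(1 <= k < K.+1) xs k)%R in
  let ubar : 'rV[R]_n := (K%:R^-1 *: \sum_(1 <= k < K.+1) us k)%R in
  forall x u pbar p gradbar : 'rV[R]_n,
  subdifferential (conjugate g) ubar pbar ->
  subdifferential (conjugate g) u p ->
  subdifferential f xbar gradbar ->
  let I_f : \bar R :=
    (K%:R^-1)%:E * (\sum_(1 <= k < K.+1)
      (f xbar - f (xs k) + (inner gradbar (xs k - xbar)%R)%:E)) +
    (K%:R^-1)%:E * (\sum_(1 <= k < K.+1)
      (f (xs k) - f x + (inner (gradf k) (x - xs k)%R)%:E)) in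
  let I_g : \bar R :=
    (K%:R^-1)%:E * (\sum_(1 <= k < K.+1)
      (g (ps k) - g pbar + (inner (us k) (pbar - ps k)%R)%:E)) +
    (K%:R^-1)%:E * (\sum_(1 <= k < K.+1)
      (g p - g (ps k) + (inner u (ps k - p)%R)%:E)) in
  let S_1 : R :=
    ((alpha * K.+1%:R)^-1 *
     (enorm (xs 0%N - x - (alpha * K.+1%:R / (2 * K%:R)) *:
                          \sum_(1 <= k < K.+1) vs k) ^+ 2 +
      alpha ^+ 2 *
      enorm (us 0%N - u - (K.+1%:R / (2 * K%:R)) *:
                          \sum_(1 <= k < K.+1) vs k) ^+ 2))%R in
  let S_2 : R :=
    (alpha / (2 * K%:R ^+ 2) *
     \sum_(1 <= k < K.+1) \sum_(1 <= l < k) enorm (vs k - vs l) ^+ 2)%R in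
  lagrangian f g xbar u - lagrangian f g x ubar
    - ((alpha * K.+1%:R)^-1 *
       (enorm (xs 0%N - x) ^+ 2 + alpha ^+ 2 * enorm (us 0%N - u) ^+ 2))%:E
  = I_f + I_g - S_1%:E - S_2%:E.
Proof.
move=> ps gradf vs; have gs_ccp := conjugate_ccp g_ccp.
have aN0 : alpha != 0%R by rewrite gt_eqF.
have subs k : (1 <= k)%N ->
    subdifferential (conjugate g) (us k) (ps k) /\
    subdifferential f (xs k) (gradf k).
  case: k => // k _; split.
    have aV0 : (0 < alpha^-1)%R by rewrite invr_gt0.
    have := prox_subgradient gs_ccp aV0 (us k + alpha^-1 *: xs k)%R.
    rewrite /= -us_step; congr (subdifferential _ _ _).
    by apply/rowP => i; rewrite !mxE; field.
  have := prox_subgradient f_ccp alpha_gt0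
    (xs k - alpha *: (2 *: us k.+1 - us k))%R.
  by rewrite /= -xs_step.
split => // K K1 xbar ubar x u pbar p gradbar sub_ubar sub_u sub_xbar.
move=> I_f I_g S_1 S_2.
have fbE := ccp_subdifferential_fin f_ccp sub_xbar.
have fE k : (1 <= k)%N -> f (xs k) = (fine (f (xs k)))%:E.
  by move=> /subs[_]; exact: ccp_subdifferential_fin.
have gE k : (1 <= k)%N -> g (ps k) = (fine (g (ps k)))%:E.
  by move=> /subs[/(conjugate_subdifferential_eq g_ccp)[]].
have [gpbE cbE] := conjugate_subdifferential_eq g_ccp sub_ubar.
have [gpE cE] := conjugate_subdifferential_eq g_ccp sub_u.
have lagE : lagrangian f g xbar u =
    (fine (f xbar) + inner u xbar - (inner p u - fine (g p)))%:E.
  by rewrite /lagrangian fbE ltry cE ltry -EFinD.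
rewrite lagE.
have [fx|] := boolP (f x < +oo); last first.
  (* Both sides are -oo, the right one because of the second sum of I_f. *)
  move=> nfx; have fxE : f x = +oo by apply/eqP; rewrite -leye_eq leNgt.
  have -> : lagrangian f g x ubar = +oo by rewrite /lagrangian fxE ltxx.
  rewrite /I_f (eq_big_nat _ _ (F2 := fun=> -oo)
    (F1 := fun k => f (xs k) - f x + _)); last first.
    by move=> k _; rewrite fxE addeNy addNye.
  by rewrite sum_ninfty// gt0_muleNy ?lte_fin ?invr_gt0 ?ltr0n// !(addeNy, addNye).
have fxE := ccp_fineK f_ccp fx.
have -> : lagrangian f g x ubar =
    (fine (f x) + inner ubar x - (inner pbar ubar - fine (g pbar)))%:E.
  by rewrite /lagrangian fx fxE cbE ltry -EFinD.
rewrite /I_f /I_g fbE fxE gpE gpbE.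
rewrite (eq_big_nat _ _ (F1 := fun k => _ - f (xs k) + _) (F2 := fun k =>
  (fine (f xbar) - fine (f (xs k)) + inner gradbar (xs k - xbar))%R%:E)); last first.
  by move=> k /andP[k1 _]; rewrite [in LHS](fE _ k1) -EFinB -EFinD.
rewrite (eq_big_nat _ _ (F1 := fun k => f (xs k) - _ + _) (F2 := fun k =>
  (fine (f (xs k)) - fine (f x) + inner (gradf k) (x - xs k))%R%:E)); last first.
  by move=> k /andP[k1 _]; rewrite [in LHS](fE _ k1) -EFinB -EFinD.
rewrite (eq_big_nat _ _ (F1 := fun k => g (ps k) - _ + _) (F2 := fun k =>
  (fine (g (ps k)) - fine (g pbar) + inner (us k) (pbar - ps k))%R%:E)); last first.
  by move=> k /andP[k1 _]; rewrite [in LHS](gE _ k1) -EFinB -EFinD.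
rewrite (eq_big_nat _ _ (F1 := fun k => _ - g (ps k) + _) (F2 := fun k =>
  (fine (g p) - fine (g (ps k)) + inner u (ps k - p))%R%:E)); last first.
  by move=> k /andP[k1 _]; rewrite [in LHS](gE _ k1) -EFinB -EFinD.
rewrite !sumEFin -!EFinM -!EFinD; congr EFin.
have psE k : (0 < k)%N -> ps k = (xs k + alpha *: (gradf k + us k))%R.
  by case: k => // k _; apply/rowP => i; rewrite !mxE /=; field.
rewrite (sum_gaps _ _ _ _ _ _ _ _ _ _ _ K1 psE).
(* One step of the iteration moves xs + alpha * us by - alpha * vs. *)
have zE k : (xs k + alpha *: us k =
    xs 0%N + alpha *: us 0%N - alpha *: \sum_(1 <= j < k.+1) vs j)%R.
  elim: k => [|k IH]; first by rewrite big_geq// scaler0 subr0.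
  rewrite big_nat_recr//= scalerDr opprD addrA -IH.
  by apply/rowP => i; rewrite !mxE /=; field.
have := mean_inner_prefix vs (xs 0%N) (us 0%N) x u alpha_gt0 K1.
under eq_bigr do rewrite -zE.
move=> ->; rewrite -/S_1 -/S_2 -/xbar -/ubar; ring.
Qed.
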